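(* Let $\omega_0>0$, $\zeta>1$ and $u^-\in\mathcal{L}^2([0,2\pi];\mathbb{R})$. Put $\alpha=\omega_0\zeta$, $\beta=\omega_0\sqrt{\zeta^2-1}$ and $\eta=\frac12\ln\left|\frac{\beta+\alpha}{\beta-\alpha}\right|$. The projection of $u^-$ onto $\mathcal{A}_{\omega_0,\zeta}$, i.e. the solution of the problem of minimizing $\frac12\|u-u^-\|_{\mathcal{L}^2}^2$ subject to $u\in\mathcal{A}_{\omega_0,\zeta}$, is given by $$P_{\mathcal{A}_{\omega_0,\zeta}}(u^-)(t)=u^-(t)+\frac{e^{\alpha(t-2\pi)}}{\beta^2(y_{11}y_{22}-y_{12}y_{21})}\bigg(-\big(y_{22}\sinh(\beta t)+y_{12}\omega_0\sinh(\beta t+\eta)\big)\Big(\hat x_1-\frac{\beta s_f}{e^{-2\pi\alpha}}\Big)+\big(y_{21}\sinh(\beta t)+y_{11}\omega_0\sinh(\beta t+\eta)\big)\Big(\hat x_2-\frac{\beta v_f}{e^{-2\pi\alpha}}\Big)\bigg),$$ where $$y_{11}=\frac{e^{-2\pi\alpha}}{4\omega_0^2}\left(\frac{(1-e^{4\pi\alpha})\cosh(2\pi\beta)}{\alpha}+\frac{(1+e^{4\pi\alpha})\sinh(2\pi\beta)}{\beta}\right),\qquad y_{12}=\frac{\sinh(2\pi\alpha)\sinh(2\pi\beta)}{2\alpha\beta},$$ $$y_{21}=-\frac{\sinh(2\pi\alpha)\sinh(2\pi\beta)}{2\alpha\beta},\qquad y_{22}=\frac{e^{-2\pi\alpha}}{4}\left(\frac{(1-e^{4\pi\alpha})\cosh(2\pi\beta)}{\alpha}-\frac{(1+e^{4\pi\alpha})\sinh(2\pi\beta)}{\beta}\right),$$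 and $(\hat x_1,\hat x_2):=\beta e^{2\pi\alpha}(x_1(2\pi),x_2(2\pi))$, with $(x_1,x_2)$ the solution of $\dot x_1=x_2$, $\dot x_2=-\omega_0^2x_1-2\zeta\omega_0x_2+u^-$, $x_1(0)=s_0$, $x_2(0)=v_0$.
   Context: $\mathcal{L}^2([0,2\pi];\mathbb{R})$ is the Hilbert space of square-integrable functions (identified when equal almost everywhere) and $\mathcal{W}^{1,2}([0,2\pi];\mathbb{R}^2)$ the space of absolutely continuous functions in $\mathcal{L}^2$ with derivative in $\mathcal{L}^2$. For given $s_0,s_f,v_0,v_f\in\mathbb{R}$ (with $t_f=2\pi$), $$\mathcal{A}_{\omega_0,\zeta}:=\{u\in\mathcal{L}^2([0,2\pi];\mathbb{R}):\exists x\in\mathcal{W}^{1,2}([0,2\pi];\mathbb{R}^2)\text{ with }\dot x_1=x_2,\ \dot x_2=-\omega_0^2x_1-2\zeta\omega_0x_2+u,\ x_1(0)=s_0,\ x_1(2\pi)=s_f,\ x_2(0)=v_0,\ x_2(2\pi)=v_f\}.$$ *)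

(* Defs.v *)
From HB Require Import structures.
From mathcomp Require Import all_boot all_order all_algebra.
From mathcomp Require Import all_classical all_reals all_analysis.
Import Order.TTheory GRing.Theory Num.Theory.
Import numFieldNormedType.Exports.

Set Implicit Arguments.
Unset Strict Implicit.
Unset Printing Implicit Defensive.

Local Open Scope classical_set_scope.
Local Open Scope ring_scope.

Definition sinh {R : realType} (x : R) : R := (expR x - expR (- x)) / 2.

Definition cosh {R : realType} (x : R) : R := (expR x + expR (- x)) / 2.

(* Lebesgue measure concentrated on [0, 2 pi]; functions on [0, 2 pi] are
   represented by total functions on R, of which only the values on [0, 2 pi]
   are relevant. *)
Definition muI (R : realType) : {measure set (measurableTypeR R) -> \bar R} :=
  mrestr (@lebesgue_measure R) (measurable_itv `[0, 2 * pi]).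

(* L^2([0, 2 pi]; R): classes modulo equality muI-almost everywhere. An element
   coerces to one of its representatives. *)
Notation L2 R := (LspaceType2 (muI R)).

(* The degenerate intervals l i = r i allowed here are harmless. *)
Definition absolutely_continuous {R : realType} (a b : R) (x : R -> R) : Prop :=
  forall e : R, 0 < e -> exists2 d : R, 0 < d &
    forall (n : nat) (l r : 'I_n -> R),
      (forall i, a <= l i /\ l i <= r i /\ r i <= b) ->
      trivIset [set: 'I_n] (fun i => `]l i, r i[%classic) ->
      \sum_(i < n) (r i - l i) < d ->
      \sum_(i < n) `|x (r i) - x (l i)| < e.

Definition W12 {R : realType} (x : R -> R) : Prop :=
  [/\ absolutely_continuous 0 (2 * pi) x,
      exists f : L2 R, {ae muI R, forall t, x t = f t} &
      exists g : L2 R, {ae muI R, forall t, is_derive (t : R) (1 : R) x (g t)}].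

(* x = (x1, x2) in W^{1,2}([0, 2 pi]; R^2), taken componentwise. *)
Definition trajectory {R : realType} (omega0 zeta : R) (u : L2 R)
    (x1 x2 : R -> R) : Prop :=
  [/\ W12 x1, W12 x2,
      {ae muI R, forall t, is_derive (t : R) (1 : R) x1 (x2 t)} &
      {ae muI R, forall t, is_derive (t : R) (1 : R) x2
         (- omega0 ^+ 2 * x1 t - 2 * zeta * omega0 * x2 t + u t)}].

Definition admissible {R : realType} (omega0 zeta s0 sf v0 vf : R) :
    set (L2 R) :=
  [set u | exists x1 x2 : R -> R,
     [/\ trajectory omega0 zeta u x1 x2,
         x1 0 = s0, x1 (2 * pi) = sf, x2 0 = v0 & x2 (2 * pi) = vf]].

Definition objective {R : realType} (um u : L2 R) : \bar R :=
  ((2^-1)%:E * 'N[muI R]_2%:E[(fun t => (u t - um t)%:E)] ^+ 2)%E.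

Definition is_projection {R : realType} (A : set (L2 R)) (um p : L2 R) : Prop :=
  A p /\ forall u, A u -> (objective um p <= objective um u)%E.

(* Main.v *)
Require Import Defs.
From HB Require Import structures.
From mathcomp Require Import all_boot all_order all_algebra.
From mathcomp Require Import all_classical all_reals all_analysis.
From mathcomp Require Import measurable_realfun ring lra.
Import Order.TTheory GRing.Theory Num.Theory.
Import numFieldNormedType.Exports.
Local Open Scope classical_set_scope.
Local Open Scope ring_scope.

(** With alpha = omega0 zeta and beta = omega0 sqrt (zeta^2 - 1), the matrix of
    the oscillator has the two real eigenvalues r = - alpha + beta and
    q = - alpha - beta. Along a trajectory driven by u, the combination
    z = x2 - q x1 satisfies z' = r z + u almost everywhere, so that
    exp (- r t) z(t) - int_0^t exp (- r s) u(s) ds is absolutely continuous with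
    an almost everywhere zero derivative, hence constant. The same holds with r
    and q exchanged. Conversely the two modes can be integrated explicitly, so
    every u in L^2 has a trajectory with prescribed initial values. Therefore
    the admissible set is the affine subspace of L^2 cut out by two linear
    equations, <exp (- r .), u> = c_r and <exp (- q .), u> = c_q
    ([admissibleP]).

    The projection of um onto such a subspace is um + w, where w is the
    combination of the two exponentials for which um + w satisfies both
    equations: for u admissible, w is orthogonal to u - um - w and Pythagoras'
    theorem gives minimality and uniqueness ([projection_of_orthogonal],
    [projection_of_moments]). The explicit formula is a combination of
    exp (- r t) = exp ((alpha - beta) t) and exp (- q t) =
    exp ((alpha + beta) t), and its moments are the required ones by an identity
    between rational functions of alpha, beta, exp (2 pi alpha) and
    exp (2 pi beta) ([moment_slow], [moment_fast]). The denominator does not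
    vanish, since
    y11 y22 - y12 y21 = ((sinh (2 pi alpha) / alpha)^2
                         - (sinh (2 pi beta) / beta)^2) / (4 omega0^2)
    and x |-> sinh x / x is strictly increasing on the positive reals
    ([det_ycoefE], [sinh_quotient_lt]).

    The one delicate point of real analysis is that an absolutely continuous
    function with almost everywhere zero derivative is constant
    ([ac_derive0_const]). *)

Set Implicit Arguments.
Unset Strict Implicit.
Unset Printing Implicit Defensive.

(** * Absolutely continuous functions with zero derivative *)

Lemma is_derive0_near (R : realType) (x : R -> R) (t e : R) : 0 < e ->
  is_derive t (1 : R) x 0 ->
  exists2 d : R, 0 < d &
    forall s, `|s - t| < d -> `|x s - x t| <= e * `|s - t|.
Proof.
move=> e0 [dx dx0].
have : h^-1 *: (x (h *: (1 : R) + t) - x t) @[h --> 0^'] --> 'D_1 x t.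
  exact: dx.
rewrite dx0.
move=> /cvgrPdist_le/(_ e e0) [d /= d0 H].
exists d => // s std; have [->|st] := eqVneq s t.
  by rewrite !subrr normr0 mulr0.
have st0 : s - t != 0 by rewrite subr_eq0.
have /= := H (s - t).
rewrite sub0r normrN => /(_ std st0).
rewrite sub0r normrN [_ *: 1]mulr1 subrK normrZ normfV.
by rewrite mulrC ler_pdivrMr ?normr_gt0.
Qed.

(** Real induction on [a, b]: a property that spreads across every point t of
    the interval, from the left of t to the right of t, reaches b. This plays
    the role of the existence of fine tagged partitions. *)
Lemma real_induction_itv (R : realType) (a b : R) (P : R -> Prop) : a <= b ->
  P a ->
  (forall t, a <= t <= b -> exists2 d : R, 0 < d & forall s s',
     a <= s <= t -> t <= s' <= b -> t - d < s -> s' < t + d ->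
     P s -> P s') ->
  P b.
Proof.
move=> ab Pa step.
pose S := [set s | a <= s <= b /\ P s].
have Sa : S a by split; rewrite ?lexx.
have hS : has_sup S.
  by split; [exists a | exists b => s [/andP[]]].
set c := sup S.
have ac : a <= c by apply: (ub_le_sup hS.2).
have cb : c <= b by apply: ge_sup; [exists a|move=> s [/andP[]]].
have acb : a <= c <= b by rewrite ac cb.
have [d d0 Hd] := step c acb.
have [s [/andP[as_ sb] Ps] cs] := sup_adherent d0 hS.
have sc : s <= c by apply: (ub_le_sup hS.2); split=> //; rewrite as_.
pose s' := Num.min b (c + d / 2).
have Ps' : P s'.
  apply: (Hd s) => //; first by rewrite as_.
    by rewrite le_min cb /= ge_min lexx /= lerDl divr_ge0 // ltW.
  by rewrite gt_min; apply/orP; right; rewrite ltrD2l; lra.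
have s'b : s' <= b by rewrite ge_min lexx.
have cs' : c <= s' by rewrite le_min cb /= lerDl divr_ge0 // ltW.
have s'c : s' <= c.
  by apply: (ub_le_sup hS.2); split=> //; rewrite s'b andbT (le_trans ac).
have : s' = b; last by move=> <-.
move: s'c; rewrite /s' ge_min => /orP[bc|]; last lra.
by apply/min_idPl; lra.
Qed.

Lemma sorted_trivIset_oo (R : realType) n (l r : nat -> R) :
  (forall i j, (i < j < n)%N -> r i <= l j) ->
  trivIset [set: 'I_n] (fun i => `]l i, r i[%classic).
Proof.
move=> H; apply/trivIsetP => i j _ _ ij; apply/seteqP; split=> // t /=.
rewrite !in_itv /= => -[/andP[li ri] /andP[lj rj]].
have := ij; rewrite neq_ltn => /orP[lt|lt].
  by have := H i j; rewrite lt ltn_ord => /(_ isT); lra.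
by have := H j i; rewrite lt ltn_ord => /(_ isT); lra.
Qed.

Lemma sum_length_le_measure (R : realType) (n : nat) (l r : 'I_n -> R)
    (U : set R) (c : R) :
  measurable U ->
  (forall i, l i <= r i) ->
  trivIset [set: 'I_n] (fun i => `]l i, r i[%classic) ->
  (forall i, `]l i, r i[ `<=` U) ->
  (lebesgue_measure U < c%:E)%E ->
  \sum_(i < n) (r i - l i) < c.
Proof.
move=> mU lr tI IU Uc; rewrite -lte_fin; apply: le_lt_trans Uc.
have -> : ((\sum_(i < n) (r i - l i))%:E =
  \sum_(i < n) lebesgue_measure (`]l i, r i[%classic : set R))%E.
  rewrite -sumEFin; apply: eq_bigr => i _.
  rewrite lebesgue_measure_itv /= lte_fin.
  have := lr i; rewrite le_eqVlt => /predU1P[->|->]; last by rewrite EFinB.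
  by rewrite ltxx subrr.
rewrite -measure_bigsetU_ord//.
apply: le_measure; rewrite ?inE//.
- by apply: bigsetU_measurable => i _; exact: measurable_itv.
- by elim/big_ind : _ => // A B AU BU; rewrite subUset.
Qed.

(** The exceptional null set is enclosed in an open set U of measure less than
    the d of absolute continuity. Real induction shows that the increment of x
    on [a, s] is at most e (s - a), from the points where the derivative is
    zero, plus the increments over finitely many disjoint intervals contained in
    U, which add up to less than e. *)
Lemma ac_derive0_const (R : realType) (a b : R) (x : R -> R) :
  a <= b -> absolutely_continuous a b x ->
  {ae @lebesgue_measure R, forall t, a <= t <= b -> is_derive t (1 : R) x 0} ->
  x b = x a.
Proof.
move=> ab acx [B [mB B0 NB]].
suff H e : 0 < e -> `|x b - x a| <= e * (b - a) + e.
  apply/eqP; rewrite -subr_eq0 -normr_le0; apply/ler_addgt0Pr => e e0.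
  rewrite add0r; pose e' := e / (b - a + 1).
  have ba1 : 0 < b - a + 1 by lra.
  have e'0 : 0 < e' by rewrite divr_gt0.
  apply: (le_trans (H _ e'0)).
  by rewrite -[X in _ + X]mulr1 -mulrDr /e' divfK // gt_eqF.
move=> e0; have [d d0 acd] := acx e e0.
have muBoo : (lebesgue_measure B < +oo)%E by rewrite B0.
have [U [oU BU UB]] := lebesgue_regularity_outer mB muBoo d0.
have mU : measurable U by exact: open_measurable.
have Ud : (lebesgue_measure U < d%:E)%E.
  apply: le_lt_trans UB.
  have UE := @measureDI _ (measurableTypeR R) _ lebesgue_measure _ _ mU mB.
  rewrite [leLHS]UE geeDl//.
  rewrite -[leRHS]B0; apply: le_measure; rewrite ?inE//.
  exact: measurableI.
pose P s := exists n (l r : nat -> R),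
  [/\ forall i, (i < n)%N -> [/\ a <= l i, l i <= r i & r i <= s],
      forall i, (i < n)%N -> `]l i, r i[ `<=` U,
      forall i j, (i < j < n)%N -> r i <= l j &
      `|x s - x a| <= e * (s - a) + \sum_(i < n) `|x (r i) - x (l i)|].
suff [n [l [r [lrb IU srt xle]]]] : P b.
  apply: (le_trans xle); rewrite lerD2l ltW //.
  have tI := sorted_trivIset_oo srt.
  apply: (acd n _ _ _ tI) => [i|].
    by have [] := lrb i (ltn_ord i).
  apply: (sum_length_le_measure mU _ tI _ Ud) => i.
    by have [] := lrb i (ltn_ord i).
  exact: IU.
apply: (real_induction_itv ab).
  exists 0%N, (fun=> a), (fun=> a); split=> //.
  by rewrite !subrr normr0 mulr0 big_ord0 addr0.
move=> t /andP[at_ tb].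
(* At a point of B the interval [s, s'] is added to the list. *)
have [/BU Ut|nBt] := pselect (B t).
  have /nbhs_ballP[d' /= d'0 H] := open_nbhs_nbhs (conj oU Ut).
  exists d' => // s s' /andP[as_ st] /andP[ts' s'b] ds s'd.
  move=> [n [l [r [lrs IU srt xle]]]].
  exists n.+1, (fun i => if i == n then s else l i),
    (fun i => if i == n then s' else r i); split.
  - move=> i; rewrite ltnS leq_eqVlt; case: eqVneq => //= _ ilt.
      by split; lra.
    by have [? ? ?] := lrs i ilt; split; lra.
  - move=> i; rewrite ltnS leq_eqVlt; case: eqVneq => //= _ ilt; last exact: IU.
    move=> z /=; rewrite in_itv /= => /andP[sz zs']; apply: H.
    by rewrite /ball /= ltr_distl; lra.
  - move=> i j /andP[ij]; rewrite ltnS => jn.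
    have iln := leq_trans ij jn.
    rewrite (ltn_eqF iln); case: eqVneq => [_|jn'].
      by have [] := lrs i iln.
    by apply: srt; rewrite ij ltn_neqAle jn' jn.
  - rewrite big_ord_recr /= eqxx.
    under eq_bigr => i _ do rewrite (ltn_eqF (ltn_ord i)).
    rewrite (_ : x s' - x a = (x s - x a) + (x s' - x s)); last by ring.
    apply: (le_trans (ler_normD _ _)); rewrite addrA lerD2r.
    apply: (le_trans xle); rewrite lerD2r ler_pM2l //; lra.
(* At a point outside B the derivative is zero: no interval is added. *)
have dx : is_derive t (1 : R) x 0.
  apply: contrapT => ndx; apply: nBt; apply: NB => /=.
  by rewrite at_ tb => /(_ isT).
have [d' d'0 H] := is_derive0_near e0 dx.
exists d' => // s s' /andP[as_ st] /andP[ts' s'b] ds s'd.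
move=> [n [l [r [lrs IU srt xle]]]].
exists n, l, r; split => //.
  by move=> i /lrs[? ? ?]; split => //; lra.
rewrite (_ : x s' - x a = (x s - x a) + ((x s' - x t) - (x s - x t)));
  last by ring.
apply: (le_trans (ler_normD _ _)).
apply: (le_trans (lerD xle (ler_normB _ _))).
have Hs' : `|x s' - x t| <= e * (s' - t).
  rewrite -[s' - t]ger0_norm; last lra.
  by apply: H; rewrite ger0_norm; lra.
have Hs : `|x s - x t| <= e * (t - s).
  rewrite -[t - s]ger0_norm; last lra.
  rewrite (distrC t); apply: H; rewrite ler0_norm; lra.
rewrite addrAC lerD2r.
apply: (le_trans (lerD (lexx _) (lerD Hs' Hs))).
lra.
Qed.

(** * Closure properties of absolute continuity *)

Section absolutely_continuous_theory.
Context {R : realType}.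
Variables a b : R.
Implicit Types x y : R -> R.

Lemma lipschitz_ac x (K : R) :
  (forall s t, a <= s -> s <= t -> t <= b -> `|x t - x s| <= K * (t - s)) ->
  absolutely_continuous a b x.
Proof.
move=> xK e e0; pose K' := `|K| + 1.
have K'0 : 0 < K' by rewrite ltr_wpDl.
have KK' : K <= K' by rewrite (le_trans (ler_norm K))// lerDl.
exists (e / K') => [|n l r lr _ sd]; first by rewrite divr_gt0.
apply: (@le_lt_trans _ _ (K' * \sum_(i < n) (r i - l i))).
  rewrite mulr_sumr; apply: ler_sum => i _.
  have [al [lri rb]] := lr i.
  by apply: (le_trans (xK _ _ al lri rb)); rewrite ler_wpM2r // subr_ge0.
by rewrite mulrC -ltr_pdivlMr.
Qed.

Lemma ac_cst (c : R) : absolutely_continuous a b (fun=> c).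
Proof.
by apply: (@lipschitz_ac _ 0) => s t _ _ _; rewrite subrr normr0 mul0r.
Qed.

Lemma acD x y : absolutely_continuous a b x -> absolutely_continuous a b y ->
  absolutely_continuous a b (fun t => x t + y t).
Proof.
move=> acx acy e e0; have e20 : 0 < e / 2 by rewrite divr_gt0.
have [d d0 Hx] := acx _ e20; have [d' d'0 Hy] := acy _ e20.
exists (Num.min d d') => [|n l r lr tI]; first by rewrite lt_min d0.
rewrite lt_min => /andP[sd sd'].
rewrite [e]splitr.
apply: le_lt_trans (ltrD (Hx n l r lr tI sd) (Hy n l r lr tI sd')).
rewrite -big_split /=; apply: ler_sum => i _.
by rewrite opprD addrACA ler_normD.
Qed.

Lemma ac_dist x : absolutely_continuous a b x -> forall e, 0 < e ->
  exists2 d : R, 0 < d & forall s t, a <= s <= b -> a <= t <= b ->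
    `|s - t| < d -> `|x s - x t| < e.
Proof.
move=> acx e e0; have [d d0 Hx] := acx e e0; exists d => //.
suff H s t : a <= s <= b -> a <= t <= b -> s <= t -> t - s < d ->
    `|x t - x s| < e.
  move=> s t sab tab; have [st|ts] := leP s t => std.
    rewrite distrC; apply: H => //.
    by move: std; rewrite distrC ger0_norm ?subr_ge0.
  apply: H => //; first exact: ltW.
  by move: std; rewrite gtr0_norm ?subr_gt0.
move=> /andP[as_ sb] /andP[at_ tb] st std.
have := Hx 1%N (fun=> s) (fun=> t) (fun=> conj as_ (conj st tb)).
rewrite !big_ord1; apply => //.
by move=> i j _ _ _; rewrite !ord1.
Qed.

Lemma ac_within_continuous x : absolutely_continuous a b x ->
  {within `[a, b], continuous x}.
Proof.
move=> acx; apply/subspace_continuousP => t /=; rewrite in_itv /= => tab.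
apply/cvgrPdist_lt => e e0.
have [d d0 H] := ac_dist acx e0.
exists d => //= s; rewrite /ball_ => std /=; rewrite in_itv /= => sab.
exact: H.
Qed.

Lemma ac_bounded x : absolutely_continuous a b x ->
  exists2 M : R, 0 < M & forall t, a <= t <= b -> `|x t| <= M.
Proof.
move=> /ac_within_continuous cx.
have /compact_bounded[M [_ HM]] :=
  continuous_compact cx (@segment_compact _ a b).
exists (`|M| + 1) => [|t tab]; first by rewrite ltr_wpDl.
apply: HM; first by rewrite ltr_pwDr // ler_norm.
by exists t => //=; rewrite in_itv.
Qed.

Lemma acM x y : absolutely_continuous a b x -> absolutely_continuous a b y ->
  absolutely_continuous a b (fun t => x t * y t).
Proof.
move=> acx acy.
have [M M0 xM] := ac_bounded acx; have [N N0 yN] := ac_bounded acy.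
move=> e e0.
have [d d0 Hx] := acx (e / (2 * N)) ltac:(by rewrite divr_gt0 // mulr_gt0).
have [d' d'0 Hy] := acy (e / (2 * M)) ltac:(by rewrite divr_gt0 // mulr_gt0).
exists (Num.min d d') => [|n l r lr tI]; first by rewrite lt_min d0.
rewrite lt_min => /andP[sd sd'].
apply: (@le_lt_trans _ _ (N * \sum_(i < n) `|x (r i) - x (l i)| +
                          M * \sum_(i < n) `|y (r i) - y (l i)|)).
  rewrite !mulr_sumr -big_split /=; apply: ler_sum => i _.
  have [al [lri rb]] := lr i.
  rewrite (_ : _ - _ = y (r i) * (x (r i) - x (l i)) +
                       x (l i) * (y (r i) - y (l i))); last by ring.
  apply: (le_trans (ler_normD _ _)); rewrite !normrM lerD // ler_wpM2r //.
    by apply: yN; rewrite rb (le_trans al).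
  by apply: xM; rewrite al (le_trans lri).
rewrite (_ : e = N * (e / (2 * N)) + M * (e / (2 * M))).
  by apply: ltrD; rewrite ltr_pM2l //; [exact: Hx|exact: Hy].
by field; rewrite !gt_eqF.
Qed.

Lemma acZ (c : R) x : absolutely_continuous a b x ->
  absolutely_continuous a b (fun t => c * x t).
Proof. by apply: acM; exact: ac_cst. Qed.

Lemma is_derive_expR_scale (k u : R) :
  is_derive u (1 : R) (fun t => expR (k * t)) (k * expR (k * u)).
Proof.
have dk : is_derive u (1 : R) ( *%R k : R -> R) k.
  rewrite -[X in is_derive _ _ X _]/(k \*: (id : R -> R)).
  by apply: is_derive_eq; rewrite [_ *: _]mulr1.
by rewrite mulrC; apply: (@is_derive1_comp _ expR ( *%R k) u (expR (k * u)) k).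
Qed.

Lemma ac_expR (k : R) : absolutely_continuous a b (fun t => expR (k * t)).
Proof.
pose L := `|k| * expR (`|k| * (`|a| + `|b|)).
apply: (@lipschitz_ac _ L) => s t as_ st tb.
have [|c] := @MVT_segment _ (fun t => expR (k * t)) _ s t st
    (fun u _ => is_derive_expR_scale k u).
  apply: derivable_within_continuous => u _.
  by have [] := is_derive_expR_scale k u.
rewrite in_itv /= => /andP[sc ct] ->.
rewrite normrM (ger0_norm (_ : 0 <= t - s)) ?subr_ge0 // ler_wpM2r ?subr_ge0 //.
rewrite normrM ler_wpM2l // ger0_norm ?expR_ge0 // ler_expR.
apply: (le_trans (ler_norm _)); rewrite normrM ler_wpM2l //.
rewrite ler_norml; have := ler_norm a; have := ler_norm (- a).
have := ler_norm b; have := ler_norm (- b); rewrite !normrN; lra.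
Qed.

End absolutely_continuous_theory.

(** * Primitives of square-integrable functions *)

Section primitive.
Context {R : realType}.
Notation mu := (@lebesgue_measure R).
Variables (f : R -> R) (a b : R).
Hypothesis intf : mu.-integrable setT (EFin \o f).
Hypothesis intf2 : mu.-integrable setT (EFin \o (fun t => f t ^+ 2)).

Let F (y : R) := \int[mu]_(t in `[a, y]) f t.

Lemma primitiveB l r : a <= l -> l <= r ->
  F r - F l = \int[mu]_(t in `]l, r[) f t.
Proof.
move=> al lr.
rewrite /F Rintegral_itvB ?bnd_simp //; last by apply: integrableS intf.
by rewrite Rintegral_itv_bndo_bndc //; apply: integrableS intf.
Qed.

Lemma primitive_start : F a = 0.
Proof. by rewrite /F set_itv1 Rintegral_set1. Qed.

(** The inequality comes from |f| <= k f^2 + 1 / (4 k). *)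
Lemma dist_primitive_le (k : R) l r : 0 < k -> a <= l -> l <= r ->
  `|F r - F l| <= k * \int[mu]_(t in `]l, r[) f t ^+ 2 + (r - l) / (4 * k).
Proof.
move=> k0 al lr; rewrite primitiveB //.
have mI : measurable (`]l, r[%classic : set (measurableTypeR R)).
  exact: measurable_itv.
have if1 : mu.-integrable `]l, r[ (EFin \o f) by apply: integrableS intf.
have if2 : mu.-integrable `]l, r[ (EFin \o (fun t => f t ^+ 2)).
  by apply: integrableS intf2.
apply: (le_trans (le_normr_Rintegral mI if1)).
have ic : mu.-integrable `]l, r[ (EFin \o (fun=> (4 * k)^-1 : R)).
  apply: (@integrableS _ _ _ mu `[l, r]) => //; first exact: subset_itv_oo_cc.
  apply: continuous_compact_integrable; first exact: segment_compact.
  by apply: continuous_subspaceT => ?; exact: cvg_cst.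
have ikf2 : mu.-integrable `]l, r[ (EFin \o (fun t => k * f t ^+ 2)).
  by have := integrableZl mI k if2.
rewrite -RintegralZl //.
have -> : (r - l) / (4 * k) = \int[mu]_(t in `]l, r[) (4 * k)^-1.
  have muE : mu (`]l, r[%classic : set R) = (r - l)%:E.
    rewrite lebesgue_measure_itv /= lte_fin.
    by move: lr; rewrite le_eqVlt => /predU1P[->|->] //; rewrite ltxx subrr.
  by rewrite Rintegral_cst // mulrC -[r - l]/(fine (r - l)%:E) -muE.
rewrite -RintegralD //; apply: le_Rintegral => //.
- exact: integrable_norm.
- by have := integrableD mI ikf2 ic.
- move=> t _; rewrite -(real_normK (num_real (f t))) -subr_ge0.
  rewrite (_ : _ - _ = k * (`|f t| - (2 * k)^-1) ^+ 2); last first.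
    by field; rewrite gt_eqF.
  by rewrite mulr_ge0 // ?sqr_ge0 // ltW.
Qed.

(** In [dist_primitive_le], the integrals of f^2 over disjoint intervals add up
    to at most its integral over the line, so that k can be fixed first to make
    the quadratic part small; then the total length of the intervals makes the
    remaining part small. *)
Lemma primitive_ac : absolutely_continuous a b F.
Proof.
pose J := \int[mu]_t f t ^+ 2.
have J0 : 0 <= J by apply: Rintegral_ge0 => t _; rewrite sqr_ge0.
move=> e e0; pose k := e / (2 * (J + 1)).
have J1 : 0 < J + 1 by lra.
have k0 : 0 < k by rewrite divr_gt0 // mulr_gt0.
exists (2 * k * e) => [|n l r lr tI sd]; first by rewrite mulr_gt0 // mulr_gt0.
have mI (i : 'I_n) : measurable (`]l i, r i[%classic : set (measurableTypeR R)).
  exact: measurable_itv.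
have HJ : \sum_(i < n) \int[mu]_(t in `]l i, r i[) f t ^+ 2 <= J.
  rewrite -lee_fin -sumEFin.
  have fin (A : set (measurableTypeR R)) : measurable A ->
      ((\int[mu]_(t in A) f t ^+ 2)%:E = \int[mu]_(t in A) (f t ^+ 2)%:E)%E.
    move=> mA; rewrite fineK //; apply: integrable_fin_num => //.
    exact: integrableS intf2.
  rewrite (eq_bigr _ (fun i _ => fin _ (mI i))) fin //.
  rewrite -integral_bigsetU_EFin //.
  - apply: ge0_subset_integral => //.
    + by apply: bigsetU_measurable => i _; exact: mI.
    + exact: (measurable_int mu).
    + by move=> t _; rewrite lee_fin sqr_ge0.
  - exact: index_enum_uniq.
  - by apply: sub_trivIset tI.
  - apply: measurable_funS (measurable_int mu intf2) => //.
apply: (@le_lt_trans _ _ (\sum_(i < n)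
    (k * (\int[mu]_(t in `]l i, r i[) f t ^+ 2) + (r i - l i) / (4 * k)))).
  apply: ler_sum => i _; have [al [lri rb]] := lr i.
  exact: dist_primitive_le.
rewrite big_split /= -mulr_sumr -mulr_suml.
have -> : e = k * (J + 1) + (2 * k * e) / (4 * k).
  by rewrite /k; field; rewrite !gt_eqF.
apply: ler_ltD.
  by rewrite ler_pM2l // (le_trans HJ) // lerDl.
by rewrite ltr_pM2r // invr_gt0 mulr_gt0.
Qed.

(** Lebesgue's differentiation theorem. *)
Lemma primitive_ae_derive :
  {ae mu, forall t, a < t -> is_derive t (1 : R) F (f t)}.
Proof.
have locf : locally_integrable [set: R] f.
  by apply: open_integrable_locally => //; exact: openT.
have intfy y : mu.-integrable [set` Interval (BLeft a) (BRight y)] (EFin \o f).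
  by apply: integrableS intf.
have := FTC1 intfy locf.
apply: filterS; first exact: (ae_filter_ringOfSetsType mu).
move=> t H at_.
have [|dF F'] := H; first by rewrite /= lte_fin.
by split => //; rewrite -derive1E.
Qed.

End primitive.

(** * Square-integrable functions on [0, 2 pi] *)

(* Filter instances for predicates on R itself rather than on its copy
   [measurableTypeR R]. *)
#[local] Instance ae_lebesgue_filter (R : realType) :
  Filter (nbhs (almost_everywhere (@lebesgue_measure R))).
Proof. exact: (ae_filter_ringOfSetsType lebesgue_measure). Qed.

#[local] Instance ae_muI_filter (R : realType) :
  Filter (nbhs (almost_everywhere (muI R))).
Proof. exact: (ae_filter_ringOfSetsType (muI R)). Qed.

Section muI_theory.
Context {R : realType}.
Notation mu := (@lebesgue_measure R).
Notation I2pi := (`[0, 2 * pi]%classic : set R).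

Lemma twopi_gt0 : 0 < 2 * pi :> R.
Proof. by rewrite mulr_gt0 // pi_gt0. Qed.

Lemma twopi_ge0 : 0 <= 2 * pi :> R.
Proof. by rewrite mulr_ge0 // pi_ge0. Qed.

Lemma measurable_I2pi : measurable (I2pi : set (measurableTypeR R)).
Proof. exact: measurable_itv. Qed.

Lemma ae_muIP (P : R -> Prop) :
  {ae muI R, forall t, P t} <-> {ae mu, forall t, 0 <= t <= 2 * pi -> P t}.
Proof.
have IE (t : R) : I2pi t <-> 0 <= t <= 2 * pi by rewrite /= in_itv.
split=> [[B [mB B0 PB]]|[B [mB B0 PB]]].
  exists (B `&` I2pi); split => //.
    exact: (measurableI _ _ mB measurable_I2pi).
  by move=> t /= /not_implyP[/IE It nP]; split => //; exact: PB.
exists (B `|` ~` I2pi); split.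
- by apply: measurableU => //; apply: measurableC; exact: measurable_I2pi.
- rewrite /muI /= /mrestr setIUl setICl setU0.
  apply/eqP; rewrite -measure_le0 -B0; apply: le_measure; rewrite ?inE //.
  by apply: measurableI => //; exact: measurable_I2pi.
- move=> t /= nP; have [It|] := pselect (I2pi t); last by right.
  by left; apply: PB => /= /(_ (proj1 (IE t) It)).
Qed.

Lemma muI_setT_fin : muI R [set: R] \is a fin_num.
Proof.
rewrite /muI /= /mrestr setTI fin_num_abs gee0_abs //.
by rewrite lebesgue_measure_itv /=; case: ifP; rewrite ?ltry.
Qed.

Lemma integral_muI (f : measurableTypeR R -> \bar R) :
  measurable_fun [set: measurableTypeR R] f ->
  (\int[muI R]_t f t = \int[mu]_(t in I2pi) f t)%E.
Proof.
move=> mf.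
have aeI : {ae muI R, forall t, I2pi t}.
  by apply/ae_muIP/aeW => t; rewrite /= in_itv.
have mfI : measurable_fun [set: measurableTypeR R] (f \_ I2pi).
  by apply/(measurable_restrictT _ measurable_I2pi); exact: measurable_funS mf.
transitivity (\int[muI R]_t (f \_ I2pi) t)%E.
  apply: ae_eq_integral => //.
  by apply: filterS aeI => t It _; rewrite patchE mem_set.
rewrite -integral_mkcond; apply: eq_measure_integral => A mA AI.
by rewrite /muI /= /mrestr setIidl.
Qed.

Lemma integrable_muI (f : measurableTypeR R -> \bar R) :
  measurable_fun [set: measurableTypeR R] f ->
  (muI R).-integrable setT f <-> mu.-integrable I2pi f.
Proof.
move=> mf; split => /integrableP[_ fi]; apply/integrableP; split => //.
- exact: measurable_funS mf.
- by rewrite -integral_muI //; exact: measurableT_comp.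
- by rewrite integral_muI //; exact: measurableT_comp.
Qed.

Lemma Lnorm2E (f : measurableTypeR R -> R) :
  measurable_fun [set: measurableTypeR R] f ->
  ('N[muI R]_2%:E[EFin \o f] = (\int[muI R]_t (f t ^+ 2)%:E) `^ 2^-1)%E.
Proof.
move=> mf; rewrite unlock; congr poweR; apply: eq_integral => t _.
by rewrite /= powR_mulrn // -normrX ger0_norm // sqr_ge0.
Qed.

Lemma Lfun2P (f : measurableTypeR R -> R) : f \in Lfun (muI R) 2%:E <->
  measurable_fun [set: measurableTypeR R] f /\
  (muI R).-integrable setT (EFin \o (fun t => f t ^+ 2)).
Proof.
split=> [fL|[mf fi]].
  split; last exact: Lfun2_integrable_sqr.
  by move: fL; rewrite inE => /andP[/[!inE]].
rewrite inE; apply/andP; split; rewrite inE //=.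
rewrite /finite_norm Lnorm2E // poweR_lty //.
exact: integrable_lty.
Qed.

Lemma Lfun2_bounded (f : measurableTypeR R -> R) (M : R) :
  measurable_fun [set: measurableTypeR R] f ->
  (forall t, 0 <= t <= 2 * pi -> `|f t| <= M) -> f \in Lfun (muI R) 2%:E.
Proof.
move=> mf fM; apply/Lfun2P; split => //; apply/integrable_muI.
  by apply/measurable_EFinP; exact: measurable_funX.
apply: measurable_bounded_integrable.
- exact: measurable_I2pi.
- exact: compact_finite_measure (@segment_compact _ _ _).
- by apply: measurable_funS (measurable_funX _ mf).
- exists (M ^+ 2); split; rewrite ?num_real // => N MN t; rewrite /= in_itv /=.
  move=> /fM ftM; rewrite normrX; apply: le_trans (ltW MN).
  by rewrite lerXn2r ?nnegrE // (le_trans (normr_ge0 (f t))).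
Qed.

Lemma Lfun2_integrable (f : measurableTypeR R -> R) : f \in Lfun (muI R) 2%:E ->
  (muI R).-integrable setT (EFin \o f).
Proof. by move=> fL; apply/Lfun1_integrable/(Lfun_subset12 muI_setT_fin). Qed.

Lemma Lfun2_mul_integrable (f g : measurableTypeR R -> R) :
  f \in Lfun (muI R) 2%:E -> g \in Lfun (muI R) 2%:E ->
  (muI R).-integrable setT (EFin \o (fun t => f t * g t)).
Proof. by move=> fL gL; apply/Lfun1_integrable/(Lfun2_mul_Lfun1 fL gL). Qed.

Lemma L2_Lfun (u : L2 R) : (u : R -> R) \in Lfun (muI R) 2%:E.
Proof.
rewrite inE; apply/andP; split; rewrite inE /=.
  have := measurable_funPT (repr (LebesgueSpace.sort u)).
  exact.
exact: Lebesgue_finite.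
Qed.

Lemma L2_eq (u v : L2 R) : {ae muI R, forall t, u t = v t} -> u = v.
Proof.
move=> uv.
have sE : LebesgueSpace.sort u = LebesgueSpace.sort v.
  rewrite -[LHS]reprK -[RHS]reprK; apply/eqmodP; rewrite /= /equiv /=.
  by apply/asboolP; apply: filterS uv.
case: u v sE {uv} => [u [[cu]]] [v [[cv]]] /= E.
by case: _ / E cv => cv; congr (LebesgueSpace.Pack (LebesgueSpace.Class _));
  congr (isFinLebesgue.Axioms_ _ _); exact: Prop_irrelevance.
Qed.

Lemma Lfun_L2 (f : measurableTypeR R -> R) : f \in Lfun (muI R) 2%:E ->
  exists p : L2 R, {ae muI R, forall t, p t = f t}.
Proof.
move=> /Lfun2P[mf f2].
pose g : {mfun measurableTypeR R >-> measurableTypeR R} :=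
  @mfun_Sub _ _ (measurableTypeR R) (measurableTypeR R) f (mem_set mf).
pose pg : aeEqMfun (measurableTypeR R) (muI R) :=
  \pi_(aeEqMfun (measurableTypeR R) (muI R))%qT g.
have pgf : {ae muI R, forall t, repr pg t = f t}.
  have : (\pi_(aeEqMfun (measurableTypeR R) (muI R)) (repr pg) =
          \pi_(aeEqMfun (measurableTypeR R) (muI R)) g)%qT.
    exact: reprK.
  by move=> /eqmodP /= /asboolP; apply: filterS => t /(_ I).
have mrepr : measurable_fun [set: measurableTypeR R] (repr pg : _ -> R).
  have := measurable_funPT (repr pg); exact.
have fn : finite_norm (muI R) 2%:E (repr pg).
  have -> : finite_norm (muI R) 2%:E (repr pg) =
      ('N[muI R]_2%:E[EFin \o (repr pg : _ -> R)] < +oo)%E by [].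
  rewrite Lnorm2E // poweR_lty //.
  rewrite (ae_eq_integral (fun t => (f t ^+ 2)%:E)) //.
  - exact: integrable_lty.
  - by apply/measurable_EFinP; exact: measurable_funX.
  - exact: (measurable_int (muI R)).
  - by apply: filterS pgf => t /= ->.
pose p : L2 R := LebesgueSpace.Pack
  (LebesgueSpace.Class (@isFinLebesgue.Axioms_ _ _ _ _ _ (lee1n 2) pg fn)).
by exists p.
Qed.

End muI_theory.

(** * Projection in the space of square-integrable functions *)

Section projection.
Context {R : realType}.
Notation mu := (@lebesgue_measure R).
Notation I2pi := (`[0, 2 * pi]%classic : set R).
Notation J f := (\int[muI R]_t f t).
Implicit Types f g : measurableTypeR R -> R.

Lemma Lfun2_lin f g (c : R) : f \in Lfun (muI R) 2%:E ->
  g \in Lfun (muI R) 2%:E -> (fun t => c * f t + g t) \in Lfun (muI R) 2%:E.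
Proof.
move=> fL gL; have [_ H] := @Lfun_submod_closed _ _ _ (muI R) _ (lee1n 2).
exact: H.
Qed.

Lemma Lfun2B f g : f \in Lfun (muI R) 2%:E ->
  g \in Lfun (muI R) 2%:E -> (fun t => f t - g t) \in Lfun (muI R) 2%:E.
Proof.
move=> fL gL; have -> : (fun t => f t - g t) = (fun t => -1 * g t + f t).
  by apply/funext => t; ring.
exact: Lfun2_lin.
Qed.

Lemma Lfun2M_bounded f g (M : R) : measurable_fun [set: measurableTypeR R] g ->
  (forall t, 0 <= t <= 2 * pi -> `|g t| <= M) ->
  f \in Lfun (muI R) 2%:E -> (fun t => g t * f t) \in Lfun (muI R) 2%:E.
Proof.
move=> mg gM /Lfun2P[mf f2]; apply/Lfun2P; split; first exact: measurable_funM.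
apply/integrable_muI.
  by apply/measurable_EFinP; apply: measurable_funX; exact: measurable_funM.
have {}f2 : mu.-integrable I2pi (EFin \o (fun t => f t ^+ 2)).
  by apply/integrable_muI => //; apply/measurable_EFinP; exact: measurable_funX.
apply: (le_integrable (measurable_I2pi)
    (g := EFin \o (fun t => M ^+ 2 * f t ^+ 2))).
- apply/measurable_EFinP; apply: measurable_funX.
  exact: measurable_funS (measurable_funM mg mf).
- move=> t; rewrite /= in_itv /= => /gM gtM.
  rewrite lee_fin exprMn [leLHS]normrM [leRHS]normrM.
  by rewrite ler_wpM2r // !normrX lerXn2r ?nnegrE // (le_trans gtM) // ler_norm.
- by have := integrableZl measurable_I2pi (M ^+ 2) f2.
Qed.

Lemma Lfun2_expR (k : R) : (fun t => expR (k * t)) \in Lfun (muI R) 2%:E.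
Proof.
have [M _ HM] := ac_bounded (ac_expR 0 (2 * pi) k).
by apply: Lfun2_bounded HM; exact: measurableT_comp.
Qed.

Lemma Lfun2_expRM (k : R) f : f \in Lfun (muI R) 2%:E ->
  (fun t => expR (k * t) * f t) \in Lfun (muI R) 2%:E.
Proof.
have [M _ HM] := ac_bounded (ac_expR 0 (2 * pi) k).
by apply: Lfun2M_bounded HM; exact: measurableT_comp.
Qed.

Lemma ae_eq_Rintegral f g :
  measurable_fun [set: measurableTypeR R] f ->
  measurable_fun [set: measurableTypeR R] g ->
  {ae muI R, forall t, f t = g t} -> J f = J g.
Proof.
move=> mf mg fg; congr fine; apply: ae_eq_integral => //.
- exact/measurable_EFinP.
- exact/measurable_EFinP.
- by apply: filterS fg => t ->.
Qed.

Lemma Lfun2_measurable f : f \in Lfun (muI R) 2%:E ->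
  measurable_fun [set: measurableTypeR R] f.
Proof. by move=> /Lfun2P[]. Qed.

Lemma objectiveE (um u : L2 R) :
  objective um u = (2^-1 * J (fun t => (u t - um t) ^+ 2))%:E.
Proof.
have dL := Lfun2B (L2_Lfun u) (L2_Lfun um).
have [md d2] := (Lfun2P _).1 dL.
pose X := (\int[muI R]_t ((u t - um t) ^+ 2)%:E)%E.
rewrite /objective.
have -> : ('N[muI R]_2%:E[(fun t => (u t - um t)%:E)] =
    X `^ 2^-1)%E by exact: Lnorm2E.
rewrite EFinM /Rintegral fineK; last exact: integrable_fin_num.
congr (_ * _)%E.
rewrite -/X.
have X0 : (0 <= X)%E by apply: integral_ge0 => t _; rewrite lee_fin sqr_ge0.
have Xf : X \is a fin_num by exact: integrable_fin_num.
rewrite -(fineK Xf) poweR_EFin -EFin_expe.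
have x0 : 0 <= fine X by rewrite fine_ge0.
by rewrite -powR_mulrn ?powR_ge0 // -powRrM mulVf // powRr1.
Qed.

Lemma Rintegral_sqr_eq0 f : f \in Lfun (muI R) 2%:E ->
  J (fun t => f t ^+ 2) <= 0 -> {ae muI R, forall t, f t = 0}.
Proof.
move=> /Lfun2P[mf f2] Jf.
have mf2 : measurable_fun [set: measurableTypeR R]
    (EFin \o (fun t => f t ^+ 2)).
  by apply/measurable_EFinP; exact: measurable_funX.
have /(ae_eq_integral_abs (muI R) measurableT mf2) :
    (\int[muI R]_t `|(EFin \o (fun t => f t ^+ 2)%R) t| = 0)%E.
  under eq_integral do rewrite /= ger0_norm ?sqr_ge0 //.
  apply/eqP; rewrite eq_le integral_ge0 ?andbT; last first.
    by move=> t _; rewrite lee_fin sqr_ge0.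
  have fin : (\int[muI R]_t (f t ^+ 2)%:E)%E \is a fin_num.
    exact: integrable_fin_num.
  by rewrite -(fineK fin) lee_fin.
by apply: filterS => t /(_ I) /= [] /eqP; rewrite sqrf_eq0 => /eqP.
Qed.

(** Pythagoras: if um + w lies in A and w is orthogonal to u - (um + w) for
    every u in A, then um + w is the unique point of A closest to um. *)
Lemma projection_of_orthogonal (A : set (L2 R)) (um : L2 R)
    (w : measurableTypeR R -> R) :
  w \in Lfun (muI R) 2%:E ->
  (forall p : L2 R, {ae muI R, forall t, p t = um t + w t} -> A p) ->
  (forall u, A u -> J (fun t => w t * (u t - um t - w t)) = 0) ->
  exists p : L2 R, [/\ is_projection A um p,
    (forall q : L2 R, is_projection A um q -> q = p) &
    {ae muI R, forall t, p t = um t + w t}].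
Proof.
move=> wL Aw Aort.
have umL := L2_Lfun um.
have pL : (fun t => um t + w t) \in Lfun (muI R) 2%:E.
  have := Lfun2_lin 1 umL wL.
  by under eq_fun do rewrite mul1r.
have [p pE] := Lfun_L2 pL.
have objp : objective um p = (2^-1 * J (fun t => w t ^+ 2))%:E.
  rewrite objectiveE; congr (_ * _)%:E; apply: ae_eq_Rintegral.
  - by apply: measurable_funX; exact: Lfun2_measurable (Lfun2B (L2_Lfun p) umL).
  - by apply: measurable_funX; exact: Lfun2_measurable.
  - by apply: filterS pE => t ->; congr (_ ^+ 2); ring.
have obju u : A u -> objective um u =
    (2^-1 * (J (fun t => (u t - um t - w t) ^+ 2) + J (fun t => w t ^+ 2)))%:E.
  move=> Au; rewrite objectiveE; congr (_ * _)%:E.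
  have dL := Lfun2B (Lfun2B (L2_Lfun u) umL) wL.
  have [_ d2] := (Lfun2P _).1 dL; have [_ w2] := (Lfun2P _).1 wL.
  have iwd := Lfun2_mul_integrable wL dL.
  have iwd2 := integrableZl measurableT 2 iwd.
  have id2w2 := integrableD measurableT d2 w2.
  transitivity (J (fun t => ((u t - um t - w t) ^+ 2 + w t ^+ 2) +
                          2 * (w t * (u t - um t - w t)))).
    by apply: eq_Rintegral => t _; ring.
  rewrite (RintegralD measurableT id2w2 iwd2).
  rewrite (RintegralD measurableT d2 w2).
  by rewrite (RintegralZl 2 measurableT iwd) Aort // mulr0 addr0.
exists p; split=> //.
  split; first exact: Aw.
  move=> u Au; rewrite objp obju // lee_fin ler_wpM2l ?invr_ge0 // lerDr.
  by apply: Rintegral_ge0 => t _; exact: sqr_ge0.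
move=> q [Aq /(_ p (Aw p pE))].
rewrite objp obju // lee_fin ler_pM2l ?invr_gt0 // gerDr => Jd.
have dL := Lfun2B (Lfun2B (L2_Lfun q) umL) wL.
have d0 := Rintegral_sqr_eq0 dL Jd.
apply: L2_eq; apply: filterS2 d0 pE => t d0 ->.
by apply/eqP; rewrite -subr_eq0 opprD addrA d0.
Qed.

End projection.

Section moments.
Context {R : realType}.
Notation J f := (\int[muI R]_t f t).
Implicit Types f g h : measurableTypeR R -> R.

Lemma Rintegral_mulDr h f g : h \in Lfun (muI R) 2%:E ->
  f \in Lfun (muI R) 2%:E -> g \in Lfun (muI R) 2%:E ->
  J (fun t => h t * (f t + g t)) =
  J (fun t => h t * f t) + J (fun t => h t * g t).
Proof.
move=> hL fL gL.
have ihf := Lfun2_mul_integrable hL fL; have ihg := Lfun2_mul_integrable hL gL.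
rewrite -(RintegralD measurableT ihf ihg).
by apply: eq_Rintegral => t _; rewrite mulrDr.
Qed.

Lemma Rintegral_mulZr h f (c : R) : h \in Lfun (muI R) 2%:E ->
  f \in Lfun (muI R) 2%:E ->
  J (fun t => h t * (c * f t)) = c * J (fun t => h t * f t).
Proof.
move=> hL fL; rewrite -(RintegralZl c measurableT (Lfun2_mul_integrable hL fL)).
by apply: eq_Rintegral => t _; rewrite mulrCA.
Qed.

Lemma Lfun2Z f (c : R) : f \in Lfun (muI R) 2%:E ->
  (fun t => c * f t) \in Lfun (muI R) 2%:E.
Proof.
move=> fL; have := Lfun2_lin (c - 1) fL fL.
by under eq_fun do rewrite mulrBl mul1r subrK.
Qed.

Lemma Lfun2D f g : f \in Lfun (muI R) 2%:E -> g \in Lfun (muI R) 2%:E ->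
  (fun t => f t + g t) \in Lfun (muI R) 2%:E.
Proof.
by move=> fL gL; have := Lfun2_lin 1 fL gL; under eq_fun do rewrite mul1r.
Qed.

Lemma Rintegral_expR (k : R) : k != 0 ->
  J (fun t => expR (k * t)) = (expR (k * (2 * pi)) - 1) / k.
Proof.
move=> k0.
have cE : continuous (fun t : R => expR (k * t)).
  move=> t; apply: continuous_comp; last exact: continuous_expR.
  exact: mulrl_continuous.
have dE t : is_derive t (1 : R) (fun t => k^-1 * expR (k * t)) (expR (k * t)).
  have H := is_derive_expR_scale k t.
  rewrite -[X in is_derive _ _ X _]/(k^-1 \*: (fun t => expR (k * t))).
  by apply: is_derive_eq; rewrite /GRing.scale /= mulKf.
rewrite /Rintegral integral_muI; last first.
  by apply/measurable_EFinP; exact: continuous_measurable_fun.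
rewrite (continuous_FTC2 (F := fun t => k^-1 * expR (k * t)) twopi_gt0) //=.
- by rewrite mulr0 expR0; ring.
- exact: continuous_subspaceT.
- have cF : continuous (fun t : R => k^-1 * expR (k * t)).
    by move=> t; apply: cvgM; [exact: cvg_cst|exact: cE].
  split.
  + by move=> t _; have [] := dE t.
  + exact: (cvg_at_right_filter (cF _)).
  + exact: (cvg_at_left_filter (cF _)).
- by move=> t _; rewrite derive1E; have [_ ->] := dE t.
Qed.

Lemma Rintegral_expR_comb (k k1 k2 c1 c2 : R) : k + k1 != 0 -> k + k2 != 0 ->
  J (fun t => expR (k * t) * (c1 * expR (k1 * t) + c2 * expR (k2 * t))) =
  c1 * ((expR ((k + k1) * (2 * pi)) - 1) / (k + k1)) +
  c2 * ((expR ((k + k2) * (2 * pi)) - 1) / (k + k2)).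
Proof.
move=> k10 k20; have kL := @Lfun2_expR R k.
have k1L := @Lfun2_expR R k1; have k2L := @Lfun2_expR R k2.
rewrite (Rintegral_mulDr kL (Lfun2Z c1 k1L) (Lfun2Z c2 k2L)).
rewrite !Rintegral_mulZr // -!Rintegral_expR //.
by congr (_ * _ + _ * _); apply: eq_Rintegral => t _; rewrite mulrDl expRD.
Qed.

(** The case of an affine subspace defined by two linear equations: the
    correction w is a combination of the two functionals' representatives. *)
Lemma projection_of_moments (A : set (L2 R)) (um : L2 R)
    (e1 e2 : measurableTypeR R -> R) (m1 m2 c1 c2 : R) :
  e1 \in Lfun (muI R) 2%:E -> e2 \in Lfun (muI R) 2%:E ->
  (forall u : L2 R, A u <-> J (fun t => e1 t * u t) = m1 /\
                            J (fun t => e2 t * u t) = m2) ->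
  J (fun t => e1 t * (c1 * e1 t + c2 * e2 t)) = m1 - J (fun t => e1 t * um t) ->
  J (fun t => e2 t * (c1 * e1 t + c2 * e2 t)) = m2 - J (fun t => e2 t * um t) ->
  exists p : L2 R, [/\ is_projection A um p,
    (forall q : L2 R, is_projection A um q -> q = p) &
    {ae muI R, forall t, p t = um t + (c1 * e1 t + c2 * e2 t)}].
Proof.
move=> e1L e2L AP J1 J2.
pose w t := c1 * e1 t + c2 * e2 t.
have wL : w \in Lfun (muI R) 2%:E by apply: Lfun2D; exact: Lfun2Z.
have umL := L2_Lfun um.
apply: (projection_of_orthogonal wL) => [p pE|u /AP[u1 u2]].
  have pL := L2_Lfun p.
  have Jp e m : e \in Lfun (muI R) 2%:E ->
      J (fun t => e t * w t) = m - J (fun t => e t * um t) ->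
      J (fun t => e t * p t) = m.
    move=> eL Je.
    transitivity (J (fun t => e t * (um t + w t))).
      apply: ae_eq_Rintegral.
      - by apply: measurable_funM; exact: Lfun2_measurable.
      - by apply: measurable_funM; apply: Lfun2_measurable => //; exact: Lfun2D.
      - by apply: filterS pE => t ->.
    by rewrite Rintegral_mulDr // Je addrC subrK.
  by apply/AP; split; exact: Jp.
have uL := L2_Lfun u.
have dL := Lfun2B (Lfun2B uL umL) wL.
have Jd e m : e \in Lfun (muI R) 2%:E ->
    J (fun t => e t * w t) = m - J (fun t => e t * um t) ->
    J (fun t => e t * u t) = m ->
    J (fun t => (u t - um t - w t) * e t) = 0.
  move=> eL Je Ju.
  transitivity (J (fun t => e t * (u t + (-1) * (um t + w t)))).
    by apply: eq_Rintegral => t _; ring.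
  rewrite Rintegral_mulDr //; last by apply: Lfun2Z; exact: Lfun2D.
  rewrite Rintegral_mulZr //; last exact: Lfun2D.
  by rewrite Rintegral_mulDr // Je Ju; ring.
transitivity (J (fun t => (u t - um t - w t) * (c1 * e1 t + c2 * e2 t))).
  by apply: eq_Rintegral => t _; rewrite mulrC.
rewrite (Rintegral_mulDr dL (Lfun2Z c1 e1L) (Lfun2Z c2 e2L)).
rewrite !Rintegral_mulZr //.
by rewrite (Jd _ _ e1L J1 u1) (Jd _ _ e2L J2 u2); ring.
Qed.

End moments.

(** * Trajectories of the oscillator *)

Section trajectories.
Context {R : realType}.
Notation mu := (@lebesgue_measure R).
Notation I2pi := (`[0, 2 * pi]%classic : set R).
Notation J f := (\int[muI R]_t f t).

(** The primitive from 0 of s |-> exp (k s) u(s). The integrand is extended by 0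
    outside [0, 2 pi], so that it is integrable on the whole line. *)
Definition expprim (k : R) (u : measurableTypeR R -> R) (t : R) : R :=
  \int[mu]_(s in `[0, t]) ((fun s => expR (k * s) * u s) \_ I2pi) s.

Lemma restrict_integrable (f : measurableTypeR R -> R) :
  f \in Lfun (muI R) 2%:E ->
  mu.-integrable setT (EFin \o (f \_ I2pi)) /\
  mu.-integrable setT (EFin \o (fun t => (f \_ I2pi) t ^+ 2)).
Proof.
move=> fL; have [mf f2] := (Lfun2P _).1 fL.
have f1 := Lfun2_integrable fL.
have rI (g : measurableTypeR R -> R) :
    measurable_fun [set: measurableTypeR R] g ->
    (muI R).-integrable setT (EFin \o g) ->
    mu.-integrable setT (EFin \o (g \_ I2pi)).
  move=> mg gi; rewrite -restrict_EFin.
  apply: (proj1 (integrable_mkcond _ measurable_I2pi)).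
  by apply/integrable_muI => //; exact/measurable_EFinP.
split; first exact: rI.
have -> : (fun t => (f \_ I2pi) t ^+ 2) = (fun t => f t ^+ 2) \_ I2pi.
  by apply/funext => t; rewrite !patchE; case: ifP => // _; rewrite expr0n.
by apply: rI => //; exact: measurable_funX.
Qed.

Section expprim_theory.
Variables (k : R) (u : measurableTypeR R -> R).
Hypothesis uL : u \in Lfun (muI R) 2%:E.

Let int := restrict_integrable (Lfun2_expRM k uL).

Lemma expprim0 : expprim k u 0 = 0.
Proof. exact: primitive_start. Qed.

Lemma expprim_ac : absolutely_continuous 0 (2 * pi) (expprim k u).
Proof. exact: (primitive_ac 0 (2 * pi) int.1 int.2). Qed.

Lemma expprim_end : expprim k u (2 * pi) = J (fun t => expR (k * t) * u t).
Proof.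
rewrite /expprim /Rintegral integral_muI; last first.
  by apply/measurable_EFinP; exact: Lfun2_measurable (Lfun2_expRM k uL).
congr fine; apply: eq_integral => t tI; by rewrite patchE tI.
Qed.

Lemma expprim_derive : {ae mu, forall t, 0 <= t <= 2 * pi ->
  is_derive t (1 : R) (expprim k u) (expR (k * t) * u t)}.
Proof.
have ne0 : {ae mu, forall t, t != 0 :> R}.
  exists [set 0]; split; first exact: measurable_set1.
    exact: lebesgue_measure_set1.
  by move=> t /= /negP; rewrite negbK => /eqP.
have := primitive_ae_derive 0 int.1.
apply: filterS2 ne0 => t t0 H /andP[t_ge0 tT].
have tgt0 : 0 < t by rewrite lt_neqAle eq_sym t0.
by have := H tgt0; rewrite patchE mem_set //= in_itv /= t_ge0.
Qed.

End expprim_theory.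

Lemma ac_restrict_Lfun2 (x : R -> R) : absolutely_continuous 0 (2 * pi) x ->
  (x \_ I2pi : measurableTypeR R -> R) \in Lfun (muI R) 2%:E.
Proof.
move=> acx; have [M _ xM] := ac_bounded acx.
have cx := ac_within_continuous acx.
apply: (@Lfun2_bounded _ _ M).
  apply/(measurable_restrictT _ measurable_I2pi).
  by apply: subspace_continuous_measurable_fun => //; exact: measurable_I2pi.
by move=> t tI; rewrite patchE mem_set ?xM //= in_itv.
Qed.

Lemma W12_intro (x : R -> R) (g : measurableTypeR R -> R) :
  absolutely_continuous 0 (2 * pi) x -> g \in Lfun (muI R) 2%:E ->
  {ae muI R, forall t, is_derive t (1 : R) x (g t)} -> W12 x.
Proof.
move=> acx gL dx; split => //.
  have [f fE] := Lfun_L2 (ac_restrict_Lfun2 acx); exists f.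
  have /ae_muIP xE : {ae mu, forall t, 0 <= t <= 2 * pi -> (x \_ I2pi) t = x t}.
    by apply: aeW => t tI; rewrite patchE mem_set //= in_itv.
  by apply: filterS2 fE xE => t -> ->.
have [h hE] := Lfun_L2 gL; exists h.
by apply: filterS2 hE dx => t -> .
Qed.

(** For roots r and q of the characteristic polynomial, the combination
    z = x2 - q x1 satisfies z' = r z + u, and exp (- r t) z(t) minus the
    primitive of exp (- r s) u(s) is constant. *)
Lemma trajectory_moment (omega0 zeta : R) (u : L2 R) (x1 x2 : R -> R)
    (r q : R) :
  r + q = - (2 * zeta * omega0) -> r * q = omega0 ^+ 2 ->
  trajectory omega0 zeta u x1 x2 ->
  expR (- r * (2 * pi)) * (x2 (2 * pi) - q * x1 (2 * pi)) =
  x2 0 - q * x1 0 + J (fun t => expR (- r * t) * u t).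
Proof.
move=> rDq rMq [[ac1 _ _] [ac2 _ _] /ae_muIP d1 /ae_muIP d2].
have uL := L2_Lfun u.
pose h t := expR (- r * t) * (x2 t - q * x1 t) - expprim (- r) u t.
have ach : absolutely_continuous 0 (2 * pi) h.
  rewrite /h; have -> : (fun t => expR (- r * t) * (x2 t - q * x1 t) -
      expprim (- r) u t) = (fun t => expR (- r * t) * (x2 t + (- q) * x1 t) +
      (-1) * expprim (- r) u t) by apply/funext => t; ring.
  apply: acD; last by apply: acZ; exact: expprim_ac.
  by apply: acM; [exact: ac_expR|apply: acD => //; exact: acZ].
have : h (2 * pi) = h 0.
  apply: (ac_derive0_const twopi_ge0 ach).
  have d3 := expprim_derive (- r) uL.
  apply: filterS3 d1 d2 d3 => t d1 d2 d3 tI.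
  have {}d1 := d1 tI; have {}d2 := d2 tI; have {}d3 := d3 tI.
  have de := is_derive_expR_scale (- r) t.
  have -> : h = (fun t => expR (- r * t)) * (x2 - q \*: x1) - expprim (- r) u.
    by [].
  apply: is_derive_eq; rewrite /GRing.scale /=.
  rewrite fctE /=.
  have -> : omega0 ^+ 2 = r * q by [].
  rewrite (_ : (- (q \*: x1)) t = - (q * x1 t)) //.
  have -> : 2 * zeta * omega0 = - (r + q) by rewrite rDq opprK.
  by ring.
rewrite /h expprim_end // expprim0 mulr0 expR0 mul1r subr0 => <-.
by rewrite subrK.
Qed.

(** The solution of z' = r z + u with z(0) = c, by variation of constants. *)
Definition mode (u : measurableTypeR R -> R) (r c t : R) : R :=
  expR (r * t) * (c + expprim (- r) u t).

Lemma mode0 u r c : mode u r c 0 = c.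
Proof. by rewrite /mode mulr0 expR0 mul1r expprim0 addr0. Qed.

Lemma mode_ac u r c : u \in Lfun (muI R) 2%:E ->
  absolutely_continuous 0 (2 * pi) (mode u r c).
Proof.
move=> uL; apply: acM; first exact: ac_expR.
by apply: acD; [exact: ac_cst|exact: expprim_ac].
Qed.

Lemma mode_derive u r c : u \in Lfun (muI R) 2%:E ->
  {ae mu, forall t, 0 <= t <= 2 * pi ->
    is_derive t (1 : R) (mode u r c) (r * mode u r c t + u t)}.
Proof.
move=> uL; apply: filterS (expprim_derive (- r) uL) => t H tI.
have dF := H tI; have dE := is_derive_expR_scale r t.
rewrite -[X in is_derive _ _ X _]/((fun t => expR (r * t)) *
  (cst c + expprim (- r) u)).
apply: is_derive_eq; rewrite /GRing.scale /= add0r.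
rewrite mulrA -expRD mulNr subrr expR0 mul1r.
rewrite (_ : (cst c + expprim (- r) u) t = c + expprim (- r) u t) // /mode.
ring.
Qed.

(** The state is recovered from the two modes z_r = x2 - q x1 and
    z_q = x2 - r x1. *)
Lemma exists_trajectory (omega0 zeta s0 v0 r q : R) (u : L2 R) :
  r + q = - (2 * zeta * omega0) -> r * q = omega0 ^+ 2 -> r != q ->
  exists x1 x2 : R -> R,
    [/\ trajectory omega0 zeta u x1 x2, x1 0 = s0 & x2 0 = v0].
Proof.
move=> rDq rMq rq; have rq0 : r - q != 0 by rewrite subr_eq0.
have uL := L2_Lfun u.
pose zr := mode u r (v0 - q * s0); pose zq := mode u q (v0 - r * s0).
pose x1 t := (r - q)^-1 * zr t + - (r - q)^-1 * zq t.
pose x2 t := r / (r - q) * zr t + - (q / (r - q)) * zq t.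
have aczr : absolutely_continuous 0 (2 * pi) zr by exact: mode_ac.
have aczq : absolutely_continuous 0 (2 * pi) zq by exact: mode_ac.
have ac1 : absolutely_continuous 0 (2 * pi) x1 by apply: acD; exact: acZ.
have ac2 : absolutely_continuous 0 (2 * pi) x2 by apply: acD; exact: acZ.
have dz : {ae mu, forall t, 0 <= t <= 2 * pi ->
    is_derive t (1 : R) zr (r * zr t + u t) /\
    is_derive t (1 : R) zq (q * zq t + u t)}.
  apply: filterS2 (mode_derive r (v0 - q * s0) uL)
    (mode_derive q (v0 - r * s0) uL) => t dr dq tI.
  by split; [exact: dr|exact: dq].
have d1 : {ae muI R, forall t, is_derive t (1 : R) x1 (x2 t)}.
  apply/ae_muIP; apply: filterS dz => t H tI; have [dr dq] := H tI.
  rewrite -[X in is_derive _ _ X _]/((r - q)^-1 \*: zr +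
    (- (r - q)^-1) \*: zq).
  apply: is_derive_eq; rewrite /GRing.scale /= /x2; field.
  by [].
have d2 : {ae muI R, forall t, is_derive t (1 : R) x2
    (- omega0 ^+ 2 * x1 t - 2 * zeta * omega0 * x2 t + u t)}.
  apply/ae_muIP; apply: filterS dz => t H tI; have [dr dq] := H tI.
  rewrite -[X in is_derive _ _ X _]/((r / (r - q)) \*: zr +
    (- (q / (r - q))) \*: zq).
  apply: is_derive_eq; rewrite /GRing.scale /= /x1 /x2 -rMq.
  have -> : 2 * zeta * omega0 = - (r + q) by rewrite rDq opprK.
  by field.
have x1E : {ae muI R, forall t, (x1 \_ I2pi) t = x1 t}.
  by apply/ae_muIP/aeW => t tI; rewrite patchE mem_set //= in_itv.
have x2E : {ae muI R, forall t, (x2 \_ I2pi) t = x2 t}.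
  by apply/ae_muIP/aeW => t tI; rewrite patchE mem_set //= in_itv.
have x1L := ac_restrict_Lfun2 ac1; have x2L := ac_restrict_Lfun2 ac2.
exists x1, x2; split; last 2 first.
- by rewrite /x1 /zr /zq !mode0; field.
- by rewrite /x2 /zr /zq !mode0; field.
split => //.
- by apply: (W12_intro ac1 x2L); apply: filterS2 d1 x2E => t + ->.
- have gL := Lfun2_lin (- omega0 ^+ 2) x1L
    (Lfun2_lin (- (2 * zeta * omega0)) x2L uL).
  apply: (W12_intro ac2 gL); apply: filterS3 d2 x1E x2E => t d2 -> ->.
  by apply: is_derive_eq d2 _; ring.
Qed.

End trajectories.

(** * Admissible controls as an affine subspace *)

Section admissible_set.
Context {R : realType}.
Notation mu := (@lebesgue_measure R).
Notation I2pi := (`[0, 2 * pi]%classic : set R).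
Notation J f := (\int[muI R]_t f t).

(** Steering to the prescribed final state amounts to two moment conditions on
    the control. In the converse direction, a trajectory with the right initial
    state has the right final state, because the two moments determine
    x2 - q x1 and x2 - r x1 at time 2 pi. *)
Lemma admissibleP (omega0 zeta s0 sf v0 vf r q : R) (u : L2 R) :
  r + q = - (2 * zeta * omega0) -> r * q = omega0 ^+ 2 -> r != q ->
  admissible omega0 zeta s0 sf v0 vf u <->
  J (fun t => expR (- r * t) * u t) =
    expR (- r * (2 * pi)) * (vf - q * sf) - (v0 - q * s0) /\
  J (fun t => expR (- q * t) * u t) =
    expR (- q * (2 * pi)) * (vf - r * sf) - (v0 - r * s0).
Proof.
move=> rDq rMq rq.
have qDr : q + r = - (2 * zeta * omega0) by rewrite addrC.
have qMr : q * r = omega0 ^+ 2 by rewrite mulrC.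
split=> [[x1 [x2 [tr x10 x1T x20 x2T]]]|[Jr Jq]].
  have := trajectory_moment qDr qMr tr; have := trajectory_moment rDq rMq tr.
  by rewrite x10 x1T x20 x2T => -> ->; split; rewrite addrC addKr.
have [x1 [x2 [tr x10 x20]]] := exists_trajectory s0 v0 u rDq rMq rq.
have := trajectory_moment rDq rMq tr; rewrite Jr x10 x20 (addrC (_ - _)) subrK.
move=> /(mulfI (lt0r_neq0 (expR_gt0 _))) Er.
have := trajectory_moment qDr qMr tr; rewrite Jq x10 x20 (addrC (_ - _)) subrK.
move=> /(mulfI (lt0r_neq0 (expR_gt0 _))) Eq.
have rq0 : r - q != 0 by rewrite subr_eq0.
have x1T : x1 (2 * pi) = sf.
  apply: (mulfI rq0); rewrite !mulrBl; lra.
exists x1, x2; split=> //.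
by move: Er; rewrite x1T => /addIr.
Qed.

End admissible_set.

(** * The coefficients of the explicit formula *)

(** Here E and F stand for exp (2 pi a) and exp (2 pi b), where a and b are
    alpha and beta, so that omega0^2 = (a - b) (a + b). *)
Section coefficients.
Variables (K : fieldType) (a b E F Y1 Y2 : K).
Hypotheses (two : 2 != 0 :> K) (a0 : a != 0) (b0 : b != 0)
  (amb : a - b != 0) (apb : a + b != 0)
  (E0 : E != 0) (F0 : F != 0).

(** The coefficients y11, y12 and y22; the coefficient y21 is - y12. *)
Definition ycoef11 := E^-1 / (4 * ((a - b) * (a + b))) *
  ((1 - E ^+ 2) * ((F + F^-1) / 2) / a + (1 + E ^+ 2) * ((F - F^-1) / 2) / b).
Definition ycoef12 := (E - E^-1) / 2 * ((F - F^-1) / 2) / (2 * a * b).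
Definition ycoef22 := E^-1 / 4 *
  ((1 - E ^+ 2) * ((F + F^-1) / 2) / a - (1 + E ^+ 2) * ((F - F^-1) / 2) / b).

Lemma four0 : 4 != 0 :> K.
Proof. by rewrite (_ : 4 = 2 * 2) ?mulf_neq0 //; ring. Qed.

Lemma det_ycoefE : ycoef11 * ycoef22 - ycoef12 * - ycoef12 =
  (((E - E^-1) / 2 / a) ^+ 2 - ((F - F^-1) / 2 / b) ^+ 2)
    / (4 * ((a - b) * (a + b))).
Proof.
rewrite /ycoef11 /ycoef22 /ycoef12; field.
by rewrite a0 b0 amb apb E0 F0 two four0.
Qed.

(** Let Y1 and Y2 be the differences multiplying the two brackets of the
    formula. Up to the common factor 1 / (E b^2 (y11 y22 - y12 y21)),
    [coef_slow] and [coef_fast] are the coefficients of exp ((a - b) t) and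
    exp ((a + b) t) in the correction. *)
Definition coef_slow := ((ycoef22 + ycoef12 * (a - b)) * Y1 -
  (- ycoef12 + ycoef11 * (a - b)) * Y2) / 2.

Definition coef_fast := (- (ycoef22 + ycoef12 * (a + b)) * Y1 +
  (- ycoef12 + ycoef11 * (a + b)) * Y2) / 2.

(** The left-hand sides of the next two identities are, up to the same
    factor, the moments of the correction against exp ((a - b) t) and
    exp ((a + b) t); the quotients are the integrals over [0, 2 pi] of
    the products of these exponentials, and the last factor is
    y11 y22 - y12 y21, by [det_ycoefE]. *)
Lemma moment_slow :
  coef_slow * ((E ^+ 2 / F ^+ 2 - 1) / (2 * (a - b))) +
  coef_fast * ((E ^+ 2 - 1) / (2 * a)) =
  E / F * (- Y2 - (a + b) * Y1) * b *
  ((((E - E^-1) / 2 / a) ^+ 2 - ((F - F^-1) / 2 / b) ^+ 2)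
    / (4 * ((a - b) * (a + b)))).
Proof.
rewrite /coef_slow /coef_fast /ycoef11 /ycoef22 /ycoef12; field.
by rewrite a0 b0 amb apb E0 F0 two four0.
Qed.

Lemma moment_fast :
  coef_slow * ((E ^+ 2 - 1) / (2 * a)) +
  coef_fast * ((E ^+ 2 * F ^+ 2 - 1) / (2 * (a + b))) =
  E * F * (- Y2 - (a - b) * Y1) * b *
  ((((E - E^-1) / 2 / a) ^+ 2 - ((F - F^-1) / 2 / b) ^+ 2)
    / (4 * ((a - b) * (a + b)))).
Proof.
rewrite /coef_slow /coef_fast /ycoef11 /ycoef22 /ycoef12; field.
by rewrite a0 b0 amb apb E0 F0 two four0.
Qed.
End coefficients.

(** The difference of the two sides, as a function of T, vanishes at 0 and has
    derivative cosh (a T) - cosh (b T), which is positive for T > 0. *)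
Lemma sinh_quotient_lt (R : realType) (a b T : R) : 0 < b -> b < a -> 0 < T ->
  sinh (T * b) / b < sinh (T * a) / a.
Proof.
move=> b0 ba T0; have a0 := lt_trans b0 ba.
pose phi t := a^-1 * (expR (a * t) - expR (- a * t)) -
  b^-1 * (expR (b * t) - expR (- b * t)).
pose dphi t := (expR (a * t) + expR (- a * t)) -
  (expR (b * t) + expR (- b * t)).
have dE t : is_derive t (1 : R) phi (dphi t).
  have h1 := is_derive_expR_scale a t; have h2 := is_derive_expR_scale (- a) t.
  have h3 := is_derive_expR_scale b t; have h4 := is_derive_expR_scale (- b) t.
  rewrite -[X in is_derive _ _ X _]/(
    (a^-1 \*: ((fun t => expR (a * t)) - (fun t => expR (- a * t)))) -
    (b^-1 \*: ((fun t => expR (b * t)) - (fun t => expR (- b * t))))).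
  by apply: is_derive_eq; rewrite /GRing.scale /= /dphi; field; rewrite !gt_eqF.
have [|c /=] := @MVT _ phi dphi 0 T T0 (fun t _ => dE t).
  by apply: derivable_within_continuous => t _; have [] := dE t.
rewrite in_itv /= => /andP[c0 cT].
have -> : phi 0 = 0 by rewrite /phi !mulr0 expR0 !subrr !mulr0 subrr.
rewrite !subr0 => phiT.
have dc : 0 < dphi c.
  rewrite /dphi !mulNr !expRN.
  have x0 : 0 < expR (b * c) by exact: expR_gt0.
  have x1 : 1 < expR (b * c) by rewrite -expR0 ltr_expR mulr_gt0.
  have xy : expR (b * c) < expR (a * c) by rewrite ltr_expR ltr_pM2r.
  move: x0 x1 xy; move: (expR (b * c)) (expR (a * c)) => x y x0 x1 xy.
  have y0 : 0 < y by rewrite (lt_trans x0).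
  rewrite (_ : _ - _ = (y - x) * (1 - (x * y)^-1)); last first.
    by field; rewrite !gt_eqF.
  rewrite mulr_gt0 ?subr_gt0 // invf_lt1 ?mulr_gt0 //.
  by rewrite (lt_trans x1) // ltr_pMr // (lt_trans x1).
have : 0 < phi T by rewrite phiT mulr_gt0.
rewrite /phi /sinh !(mulrC T) !mulNr => h; rewrite -subr_gt0.
rewrite (_ : _ - _ = (a^-1 * (expR (a * T) - expR (- (a * T))) -
  b^-1 * (expR (b * T) - expR (- (b * T)))) / 2); last first.
  by field; rewrite !gt_eqF.
by rewrite divr_gt0.
Qed.

(** Since exp (2 eta) = (a + b) / (a - b) and omega0^2 = (a - b) (a + b), the
    phase eta satisfies omega0 exp eta = a + b and omega0 exp (- eta) = a - b.
    *)
Lemma omega0_expR_eta (R : realType) (a b omega0 : R) :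
  0 < b -> b < a -> 0 < omega0 ->
  omega0 ^+ 2 = (a - b) * (a + b) ->
  omega0 * expR (2^-1 * ln `|(b + a) / (b - a)|) = a + b /\
  omega0 * expR (- (2^-1 * ln `|(b + a) / (b - a)|)) = a - b.
Proof.
move=> b0 ba o0 o2; have a0 := lt_trans b0 ba.
have amb : 0 < a - b by rewrite subr_gt0.
have apb : 0 < a + b by rewrite addr_gt0.
rewrite (_ : `|_| = (a + b) / (a - b)); last first.
  rewrite normrM normfV gtr0_norm ?ltr0_norm ?subr_lt0 ?addr_gt0 //.
  by rewrite opprB addrC.
set l := ln _; set h := expR (2^-1 * l).
have h0 : 0 < h by exact: expR_gt0.
have h2 : h ^+ 2 = (a + b) / (a - b).
  rewrite /h expr2 -expRD -mulrDl (_ : 2^-1 + 2^-1 = 1 :> R); last by field.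
  by rewrite mul1r /l lnK // posrE divr_gt0.
have oh : omega0 * h = a + b.
  apply/eqP; rewrite -(eqrXn2 (ltn0Sn 1)) ?mulr_ge0 ?ltW //.
  by rewrite exprMn h2 o2; apply/eqP; field; rewrite gt_eqF.
split => //; rewrite expRN -/h.
have -> : h^-1 = omega0 / (a + b) by rewrite -oh; field; rewrite !gt_eqF.
by rewrite mulrA -expr2 o2 mulfK // gt_eqF.
Qed.

Lemma scaled_sinhD (R : realType) (omega0 x e P Q : R) :
  omega0 * expR e = P -> omega0 * expR (- e) = Q ->
  omega0 * sinh (x + e) = (P * expR x - Q * expR (- x)) / 2.
Proof. by move=> <- <-; rewrite /sinh opprD !expRD; field. Qed.

Theorem corollary6 (R : realType) (omega0 zeta s0 sf v0 vf : R) (um : L2 R)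
    (omega0_gt0 : 0 < omega0) (zeta_gt1 : 1 < zeta) :
  let alpha := omega0 * zeta in
  let beta := omega0 * Num.sqrt (zeta ^+ 2 - 1) in
  let eta := 2^-1 * ln `|(beta + alpha) / (beta - alpha)| in
  let y11 := expR (- (2 * pi * alpha)) / (4 * omega0 ^+ 2) *
    ((1 - expR (4 * pi * alpha)) * cosh (2 * pi * beta) / alpha +
     (1 + expR (4 * pi * alpha)) * sinh (2 * pi * beta) / beta) in
  let y12 := sinh (2 * pi * alpha) * sinh (2 * pi * beta) /
    (2 * alpha * beta) in
  let y21 := - (sinh (2 * pi * alpha) * sinh (2 * pi * beta) /
    (2 * alpha * beta)) in
  let y22 := expR (- (2 * pi * alpha)) / 4 *
    ((1 - expR (4 * pi * alpha)) * cosh (2 * pi * beta) / alpha -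
     (1 + expR (4 * pi * alpha)) * sinh (2 * pi * beta) / beta) in
  (exists x1 x2 : R -> R,
    [/\ trajectory omega0 zeta um x1 x2, x1 0 = s0 & x2 0 = v0]) /\
  (forall x1 x2 : R -> R,
    trajectory omega0 zeta um x1 x2 -> x1 0 = s0 -> x2 0 = v0 ->
    let xh1 := beta * expR (2 * pi * alpha) * x1 (2 * pi) in
    let xh2 := beta * expR (2 * pi * alpha) * x2 (2 * pi) in
    exists p : L2 R,
      [/\ is_projection (admissible omega0 zeta s0 sf v0 vf) um p,
          (forall q : L2 R,
             is_projection (admissible omega0 zeta s0 sf v0 vf) um q -> q = p) &
          {ae muI R, forall t, p t = um t +
            expR (alpha * (t - 2 * pi)) /
              (beta ^+ 2 * (y11 * y22 - y12 * y21)) *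
            (- (y22 * sinh (beta * t) +
                y12 * omega0 * sinh (beta * t + eta)) *
               (xh1 - beta * sf / expR (- (2 * pi * alpha))) +
             (y21 * sinh (beta * t) +
              y11 * omega0 * sinh (beta * t + eta)) *
               (xh2 - beta * vf / expR (- (2 * pi * alpha))))}]).
Proof.
move=> alpha beta eta y11 y12 y21 y22.
have zeta0 : 0 < zeta by rewrite (lt_trans ltr01).
have z2 : 0 < zeta ^+ 2 - 1 by rewrite subr_gt0 expr_gt1 // ltW.
have alpha0 : 0 < alpha by rewrite mulr_gt0.
have beta0 : 0 < beta by rewrite mulr_gt0 // sqrtr_gt0.
have o2 : omega0 ^+ 2 = (alpha - beta) * (alpha + beta).
  rewrite -subr_sqr /alpha /beta !exprMn sqr_sqrtr ?ltW //; ring.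
have apb : 0 < alpha + beta by rewrite addr_gt0.
have amb : 0 < alpha - beta.
  by rewrite -(pmulr_lgt0 _ apb) -o2 exprn_gt0.
have betaalpha : beta < alpha by rewrite -subr_gt0.
pose r := - alpha + beta; pose q := - alpha - beta.
have rDq : r + q = - (2 * zeta * omega0) by rewrite /r /q /alpha; ring.
have rMq : r * q = omega0 ^+ 2 by rewrite o2 /r /q; ring.
have rq : r != q by rewrite -subr_eq0 /r /q; apply/eqP; lra.
split; first exact: (exists_trajectory _ _ _ rDq rMq rq).
move=> x1 x2 tr x10 x20 xh1 xh2.
have qDr : q + r = - (2 * zeta * omega0) by rewrite addrC.
have qMr : q * r = omega0 ^+ 2 by rewrite mulrC.
set E := expR (2 * pi * alpha) in y12 y21 xh1 xh2 *.
pose F := expR (2 * pi * beta).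
have E0 : 0 < E by exact: expR_gt0.
have F0 : 0 < F by exact: expR_gt0.
have EV : expR (- (2 * pi * alpha)) = E^-1 by rewrite expRN.
have FV : expR (- (2 * pi * beta)) = F^-1 by rewrite expRN.
have E2 : expR (4 * pi * alpha) = E ^+ 2.
  by rewrite /E expr2 -expRD; congr expR; ring.
have y11E : y11 = ycoef11 alpha beta E F.
  by rewrite /y11 /ycoef11 /cosh /sinh E2 EV FV -/F o2.
have y12E : y12 = ycoef12 alpha beta E F.
  by rewrite /y12 /ycoef12 /sinh EV FV -/E -/F.
have y22E : y22 = ycoef22 alpha beta E F.
  by rewrite /y22 /ycoef22 /cosh /sinh E2 EV FV -/F.
have two0 : 2 != 0 :> R by rewrite pnatr_eq0.
have a0 : alpha != 0 by rewrite gt_eqF.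
have b0 : beta != 0 by rewrite gt_eqF.
have amb0 : alpha - beta != 0 by rewrite gt_eqF.
have apb0 : alpha + beta != 0 by rewrite gt_eqF.
have E00 : E != 0 by rewrite gt_eqF.
have F00 : F != 0 by rewrite gt_eqF.
pose D := y11 * y22 - y12 * y21.
have DE := det_ycoefE two0 a0 b0 amb0 apb0 E00 F00.
rewrite -y11E -y12E -y22E -/D in DE.
(* The denominator of the formula does not vanish. *)
have D0 : 0 < D.
  rewrite DE divr_gt0 ?mulr_gt0 // subr_gt0.
  have := @sinh_quotient_lt R alpha beta (2 * pi) beta0 betaalpha (twopi_gt0).
  rewrite /sinh EV FV -/E -/F => lt.
  rewrite ltrXn2r ?nnegrE //.
    apply: divr_ge0; last exact: ltW.
    apply: divr_ge0 => //; rewrite subr_ge0 -FV ler_expR ge0_cp //.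
    by rewrite mulr_ge0 ?twopi_ge0 // ltW.
pose Y1 := xh1 - beta * sf / E^-1; pose Y2 := xh2 - beta * vf / E^-1.
(* The correction in the formula is a combination of the two exponentials. *)
pose c := (E * beta ^+ 2 * D)^-1.
pose cr := c * coef_slow alpha beta E F Y1 Y2.
pose cq := c * coef_fast alpha beta E F Y1 Y2.
pose w t := cr * expR (- r * t) + cq * expR (- q * t).
have wE t : expR (alpha * (t - 2 * pi)) / (beta ^+ 2 * D) *
    (- (y22 * sinh (beta * t) + y12 * omega0 * sinh (beta * t + eta)) * Y1 +
     (y21 * sinh (beta * t) + y11 * omega0 * sinh (beta * t + eta)) * Y2) = w t.
  have [h1 h2] := omega0_expR_eta beta0 betaalpha omega0_gt0 o2.
  rewrite -!(mulrA _ omega0) (scaled_sinhD _ h1 h2) /w /cr /cq /c.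
  rewrite /coef_slow /coef_fast.
  rewrite -y11E -y12E -y22E.
  have -> : y21 = - y12 by [].
  have -> : expR (- r * t) = expR (alpha * t) * expR (- (beta * t)).
    by rewrite -expRD /r; congr expR; ring.
  have -> : expR (- q * t) = expR (alpha * t) * expR (beta * t).
    by rewrite -expRD /q; congr expR; ring.
  have -> : expR (alpha * (t - 2 * pi)) = expR (alpha * t) / E.
    by rewrite /E -expRN -expRD; congr expR; ring.
  rewrite /sinh expRN.
  move: (expR_gt0 (beta * t)) => P0; field.
  by rewrite !gt_eqF.
(* The correction w satisfies the two moment conditions. *)
have Er : expR (- r * (2 * pi)) = E / F.
  by rewrite /E /F -expRN -expRD /r; congr expR; ring.
have Eq : expR (- q * (2 * pi)) = E * F.
  by rewrite /E /F -expRD /q; congr expR; ring.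
have Err : expR ((- r - r) * (2 * pi)) = E ^+ 2 / F ^+ 2.
  by rewrite mulrDl expRD Er; field.
have Erq : expR ((- r - q) * (2 * pi)) = E ^+ 2.
  by rewrite mulrDl expRD Er Eq; field.
have Eqr : expR ((- q - r) * (2 * pi)) = E ^+ 2 by rewrite addrC.
have Eqq : expR ((- q - q) * (2 * pi)) = E ^+ 2 * F ^+ 2.
  by rewrite mulrDl expRD Eq; ring.
have krr : - r - r = 2 * (alpha - beta) by rewrite /r; ring.
have kqq : - q - q = 2 * (alpha + beta) by rewrite /q; ring.
have krq : - r - q = 2 * alpha by rewrite /r /q; ring.
have kqr : - q - r = 2 * alpha by rewrite /r /q; ring.
have krr0 : - r - r != 0 by rewrite krr; exact: mulf_neq0.
have krq0 : - r - q != 0 by rewrite krq; exact: mulf_neq0.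
have kqr0 : - q - r != 0 by rewrite kqr; exact: mulf_neq0.
have kqq0 : - q - q != 0 by rewrite kqq; exact: mulf_neq0.
have Mr := trajectory_moment rDq rMq tr.
have Mq := trajectory_moment qDr qMr tr.
rewrite x10 x20 Er in Mr; rewrite x10 x20 Eq in Mq.
have Kr := moment_slow Y1 Y2 two0 a0 b0 amb0 apb0 E00 F00.
have Kq := moment_fast Y1 Y2 two0 a0 b0 amb0 apb0 E00 F00.
rewrite -DE in Kr; rewrite -DE in Kq.
have cD : c * (E * beta ^+ 2 * D) = 1.
  apply: mulVf; apply: mulf_neq0; last by rewrite gt_eqF.
  by rewrite mulf_neq0 // expf_neq0.
have Jr : \int[muI R]_t (expR (- r * t) *
      (cr * expR (- r * t) + cq * expR (- q * t))) =
    expR (- r * (2 * pi)) * (vf - q * sf) - (v0 - q * s0) -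
    \int[muI R]_t (expR (- r * t) * um t).
  rewrite Rintegral_expR_comb //.
  rewrite Err Erq krr krq Er /cr /cq -!(mulrA c) -mulrDr Kr.
  rewrite [RHS](_ : _ = E / F * ((vf - x2 (2 * pi)) - q * (sf - x1 (2 * pi))));
    last first.
    rewrite -addrA -opprD -Mr; ring.
  rewrite -[RHS]mulr1 -[X in _ = _ * X]cD /Y1 /Y2 /xh1 /xh2 /q; field.
  by rewrite !gt_eqF.
have Jq : \int[muI R]_t (expR (- q * t) *
      (cr * expR (- r * t) + cq * expR (- q * t))) =
    expR (- q * (2 * pi)) * (vf - r * sf) - (v0 - r * s0) -
    \int[muI R]_t (expR (- q * t) * um t).
  rewrite Rintegral_expR_comb //.
  rewrite Eqr Eqq kqr kqq Eq /cr /cq -!(mulrA c) -mulrDr Kq.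
  rewrite [RHS](_ : _ = E * F * ((vf - x2 (2 * pi)) - r * (sf - x1 (2 * pi))));
    last first.
    rewrite -addrA -opprD -Mq; ring.
  rewrite -[RHS]mulr1 -[X in _ = _ * X]cD /Y1 /Y2 /xh1 /xh2 /r; field.
  by rewrite !gt_eqF.
have [p [pP pU pE]] := projection_of_moments (Lfun2_expR (- r))
  (Lfun2_expR (- q)) (fun u => admissibleP s0 sf v0 vf u rDq rMq rq) Jr Jq.
by exists p; split => //; apply: filterS pE => t ->; rewrite EV wE.
Qed.
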